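(* Let $D$ be an integral domain and let $S$ be a unit-closed subset of the set of atoms of $D$. Then there exists an integral domain $R$ containing $D$ as a subring such that $R$ is not MCD-finite, the set of atoms of $R$ is exactly $S$, and the extension $D\subseteq R$ is division-preserving. In particular, if $S$ does not contain an infinite set of pairwise non-associate elements, then $R$ is an IDF domain.
   Context: Integral domains are commutative with identity. For a domain $D$, $D^*$ denotes the set of non-zero elements and $U(D)$ the group of units. For $x,y\in D$, $x\mid y$ in $D$ means $y=xz$ for some $z\in D$; $x,y$ are associates ($x\sim y$) if $x=uy$ for some $u\in U(D)$. An atom is an irreducible element (a non-zero non-unit that is not a product of two non-units). A subset $A\subseteq D$ is unit-closed if $ua\in A$ for all $u\in U(D)$ and $a\in A$ (the empty set is unit-closed). $D$ is an IDF domain if every non-zero element of $D$ has only a finite number (possibly zero) of pairwise non-associate irreducible divisors. For $V\subseteq D^*$, a common divisor of $V$ is an element $x\in D^*$ with $x\mid v$ for every $v\in V$. A common divisor $c$ of $V$ is a maximal common divisor (MCD) of $V$ if for every common divisor $d$ of $V$, $c\mid d$ implies $c\sim d$. $D$ is MCD-finite if every finite subset of $D^*$ has, up to associates, only finitely many (possibly zero) maximal common divisors. An extension of domains $A\subseteq B$ is division-preserving if for all $x,y\in A^*$, whenever $x$ divides $y$ in $B$, then $x$ divides $y$ in $A$. *)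

(* Defs.v *)
From mathcomp Require Import all_boot all_algebra all_classical.

Set Implicit Arguments.
Unset Strict Implicit.
Unset Printing Implicit Defensive.

Import GRing.Theory.
Local Open Scope classical_set_scope.
Local Open Scope ring_scope.

Section Divisibility.
Variable D : idomainType.
Implicit Types (x y c d : D) (A V : set D).

Definition divides x y : Prop := exists z, y = x * z.

Definition associates x y : Prop :=
  exists u, u \is a GRing.unit /\ x = u * y.

Definition atom x : Prop :=
  [/\ x != 0, x \isn't a GRing.unit &
      ~ exists a b, [/\ a \isn't a GRing.unit, b \isn't a GRing.unit
                     & x = a * b]].

Definition atoms : set D := [set x | atom x].

Definition unit_closed A : Prop :=
  forall u a, u \is a GRing.unit -> A a -> A (u * a).

Definition pairwise_nonassociate A : Prop :=
  forall x y, A x -> A y -> x <> y -> ~ associates x y.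

Definition irreducible_divisors x : set D := [set a | atom a /\ divides a x].

Definition IDF : Prop :=
  forall x, x != 0 ->
  forall A, A `<=` irreducible_divisors x -> pairwise_nonassociate A ->
  finite_set A.

Definition common_divisor V c : Prop :=
  c != 0 /\ forall v, V v -> divides c v.

Definition maximal_common_divisor V c : Prop :=
  common_divisor V c /\
  forall d, common_divisor V d -> divides c d -> associates c d.

Definition finite_up_to_associates A : Prop :=
  exists F : set D, finite_set F /\
    forall a, A a -> exists b, F b /\ associates a b.

Definition MCD_finite : Prop :=
  forall V, finite_set V -> (forall v, V v -> v != 0) ->
  finite_up_to_associates [set c | maximal_common_divisor V c].

End Divisibility.

Arguments atoms D : clear implicits.
Arguments IDF D : clear implicits.
Arguments MCD_finite D : clear implicits.

(* A domain extension A <= B is represented by an injective ring morphism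
   [f : A -> B]; injectivity is a separate hypothesis. *)
Definition division_preserving (A B : idomainType) (f : {rmorphism A -> B}) :
    Prop :=
  forall x y : A, x != 0 -> y != 0 -> divides (f x) (f y) -> divides x y.

(* Main.v *)
Require Import Defs.
From HB Require Import structures.
From mathcomp Require Import all_boot all_order all_algebra all_classical.
From mathcomp Require Import finmap wochoice zify.

(** Call an extension [phi : A -> B] of domains conservative over a set [S] of
    elements of [A] when it creates no divisibility between elements of [A],
    and when every element [g] of [B] outside [A] is kept away from [S] by a
    witness: a nonunit [a] of [A], not in [S], that divides every nonzero
    element of [A] which [g] divides.  If [S] consists of atoms and is
    unit-closed, a conservative extension has no new units, keeps the elements
    of [S] irreducible (a new divisor of [s] would make [a] divide [s], so [a]
    would be an associate of [s] and lie in [S]), and keeps coprime pairs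
    coprime.  Conservative extensions compose ([conservative_comp]) and pass to
    unions of chains ([limit_conservative]).  The ring of the theorem is
    obtained from [D] by such extensions.

    All the one-step extensions are graded.  Let [G] be an orderable abelian
    group and [I x], for [x] in [G], ideals of [D] with [I 0 = D] and
    [I x * I y <= I (x + y)].  The elements of the group algebra [D[G]] whose
    coefficient at each [x] lies in [I x] form a domain, in which a factor of a
    monomial is a monomial, because the product of the leading terms and the
    product of the trailing terms cannot cancel ([conv_eq_mono]).  Hence a
    divisor of a constant is a monomial, and being conservative becomes a
    condition on the products [I x * I (- x)] ([gconst_conservative]).

    Two gradings are used.  The first one gives [D + Y D[X, 1/X][Y]], where all
    the [X^k Y] are maximal common divisors of [Y^2] and [X Y^2]
    ([mcd_many_MCDs]).  The second one adjoins [X_a] and [a / X_a] for every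
    atom [a] outside [S], so that [a] is no longer an atom
    ([split_not_atom]); for [x <> 0] the products [I x * I (- x)] are
    contained in [a D] for some such [a], or vanish.  This step creates new
    atoms, so it is repeated: an atom of the union of the resulting chain is an
    atom at some stage, and it lies in [S], since otherwise it splits at the
    next stage ([limit_atoms]).  The infinite family of maximal common divisors
    survives because all the extensions are conservative. *)

Set Implicit Arguments.
Unset Strict Implicit.
Unset Printing Implicit Defensive.

Import Order.TTheory GRing.Theory Num.Theory.
Local Open Scope classical_set_scope.
Local Open Scope ring_scope.

(** * Divisibility and conservative extensions *)

Section Divisibility.
Variable D : idomainType.
Implicit Types (x y z u : D) (S : set D).

Lemma dividesxx x : divides x x. Proof. by exists 1; rewrite mulr1. Qed.

Lemma divides0x x : divides 0 x -> x = 0.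
Proof. by move=> [y ->]; rewrite mul0r. Qed.

Lemma divides1P x : divides x 1 <-> x \is a GRing.unit.
Proof.
by split=> [[y xy]|xu]; [apply/unitrPr; exists y | exists x^-1; rewrite divrr].
Qed.

Lemma divides_trans y x z : divides x y -> divides y z -> divides x z.
Proof. by move=> [u ->] [v ->]; exists (u * v); rewrite mulrA. Qed.

Lemma dividesMr x y z : divides x y -> divides x (y * z).
Proof. by move=> [u ->]; exists (u * z); rewrite mulrA. Qed.

Lemma dividesMl x y z : divides x y -> divides x (z * y).
Proof. by rewrite mulrC; exact: dividesMr. Qed.

Lemma atoms_neq0 S : S `<=` atoms D -> ~ S 0.
Proof. by move=> S_atoms /S_atoms[]; rewrite eqxx. Qed.

Definition coprime_pair x y : Prop :=
  forall e, divides e x -> divides e y -> e \is a GRing.unit.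

(** The common divisors [c k] of [x] and [y] are maximal because the cofactors
    are coprime.  Coprimality is recorded instead of maximality since it is
    what passes to conservative extensions. *)
Definition many_MCDs x y (c : nat -> D) : Prop :=
  [/\ x != 0, y != 0,
      forall k, exists x' y',
        [/\ x = c k * x', y = c k * y' & coprime_pair x' y']
    & forall k l, associates (c k) (c l) -> k = l].

Lemma many_MCDs_not_MCD_finite x y c : many_MCDs x y c -> ~ MCD_finite D.
Proof.
move=> [x0 y0 c_xy c_inj] /(_ [set x; y] (finite_set2 _ _)) [|F [finF F_cover]].
  by move=> v /= [|] ->.
have c_MCD k : maximal_common_divisor [set x; y] (c k).
  have [x' [y' [xE yE cop]]] := c_xy k.
  have ck0 : c k != 0 by apply: contraNneq x0 => ck0; rewrite xE ck0 mul0r.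
  split; first by split=> // v /= [|] ->; [exists x'|exists y'].
  move=> d [d0 d_xy] [e dE].
  have cancel z z' : z = c k * z' -> divides d z -> divides e z'.
    move=> zE [w dw]; exists w; apply: (mulfI ck0).
    by rewrite -zE dw dE mulrA.
  have eu : e \is a GRing.unit.
    apply: cop; [apply: cancel xE _|apply: cancel yE _]; apply: d_xy.
      by left.
    by right.
  by exists e^-1; rewrite unitrV dE mulrCA mulVr ?mulr1.
have /choice[b bP] k : exists b, F b /\ associates (c k) b.
  exact: F_cover _ (c_MCD k).
apply: infinite_nat; have -> : [set: nat] = b @^-1` F.
  by apply/seteqP; split=> // k _; exact: (bP k).1.
apply: finite_preimage finF => k l _ _ bkl; apply: c_inj.
have [[_ [u [uU ->]]] [_ [v [vU ->]]]] := (bP k, bP l).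
exists (u / v); rewrite unitrM unitrV uU vU; split=> //.
by rewrite bkl mulrA divrK.
Qed.

End Divisibility.

(** In the second clause [a = 0] is allowed: it then says that [g] divides no
    nonzero element of [A]. *)
Definition conservative (A B : idomainType) (phi : {rmorphism A -> B})
    (S : set A) : Prop :=
  (forall x y, divides (phi x) (phi y) -> divides x y) /\
  forall g : B, (exists x, g = phi x) \/
    exists a, [/\ a \isn't a GRing.unit, ~ S a
      & forall c, c != 0 -> divides g (phi c) -> divides a c].

Section Conservative.
Variables (A B : idomainType) (phi : {rmorphism A -> B}) (S : set A).
Hypothesis phi_cons : conservative phi S.
Implicit Types (x y c : A) (g : B).

Let phi_div x y : divides (phi x) (phi y) -> divides x y.
Proof. exact: phi_cons.1. Qed.

Lemma conservative_inj : injective phi.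
Proof.
apply: raddf_inj => x phix0; apply/divides0x/phi_div.
by rewrite phix0 rmorph0; exact: dividesxx.
Qed.

Lemma conservative_unit x : phi x \is a GRing.unit -> x \is a GRing.unit.
Proof.
by move=> /divides1P; rewrite -(rmorph1 phi) => /phi_div/divides1P.
Qed.

(** A unit [g] outside [A] would divide [1], and so would its witness [a]. *)
Lemma conservative_unit_lift g : g \is a GRing.unit ->
  exists2 u, u \is a GRing.unit & g = phi u.
Proof.
move=> gU; have [[x gE]|[a [aN _ a_div]]] := phi_cons.2 g.
  by exists x => //; apply: conservative_unit; rewrite -gE.
have := a_div 1 (oner_neq0 _); rewrite rmorph1.
by move=> /(_ (proj2 (divides1P g) gU))/divides1P; rewrite (negbTE aN).
Qed.

Lemma conservative_associates x y :
  associates (phi x) (phi y) -> associates x y.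
Proof.
move=> [_ [/conservative_unit_lift[u uU ->]]].
by rewrite -rmorphM => /conservative_inj ->; exists u.
Qed.

(** The witness [a] of a new common divisor depends on the divisor only, so it
    is a common divisor in [A] already. *)
Lemma conservative_coprime_pair x y : x != 0 -> y != 0 ->
  coprime_pair x y -> coprime_pair (phi x) (phi y).
Proof.
move=> x0 y0 cop g gx gy; have [[z gE]|[a [aN _ a_div]]] := phi_cons.2 g.
  by rewrite gE rmorph_unit // cop //; apply: phi_div; rewrite -gE.
by case/negP: aN; apply: cop; exact: a_div.
Qed.

Lemma conservative_many_MCDs x y (c : nat -> A) :
  many_MCDs x y c -> many_MCDs (phi x) (phi y) (phi \o c).
Proof.
have phi0 z : z != 0 -> phi z != 0.
  by rewrite raddf_eq0 //; exact: conservative_inj.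
move=> [x0 y0 c_xy c_inj]; split; [exact: phi0|exact: phi0| |].
  move=> k; have [x' [y' [xE yE cop]]] := c_xy k.
  exists (phi x'), (phi y'); rewrite -!rmorphM xE yE; split=> //.
  apply: conservative_coprime_pair cop.
    by apply: contraNneq x0 => x'0; rewrite xE x'0 mulr0.
  by apply: contraNneq y0 => y'0; rewrite yE y'0 mulr0.
by move=> k l /conservative_associates/c_inj.
Qed.

Hypotheses (S_atoms : S `<=` atoms A) (S_unit : unit_closed S).

(** If an element [s] of [S] had a factor outside [A], the witness [a] of this
    factor would divide the atom [s], hence be associated to it and lie in
    [S]. *)
Lemma conservative_atoms : phi @` S `<=` atoms B.
Proof.
move=> _ [s Ss <-]; have [s0 sN s_irr] := S_atoms Ss.
split; first by rewrite raddf_eq0 //; exact: conservative_inj.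
  by apply/negP => /conservative_unit; exact/negP.
move=> [g [h [gN hN sE]]]; have [[x gE]|[a [aN aS a_div]]] := phi_cons.2 g.
  have [|y sxy] := @phi_div x s; first by exists h; rewrite -gE.
  apply: s_irr; exists x, y; split=> //.
    by apply: contra gN => xU; rewrite gE rmorph_unit.
  apply: contra hN => yU.
  suff -> : h = phi y by rewrite rmorph_unit.
  have g0 : g != 0.
    apply: contraNneq s0 => g0; apply/eqP/conservative_inj.
    by rewrite sE g0 mul0r rmorph0.
  by apply: (mulfI g0); rewrite -sE sxy rmorphM gE.
have [|b sE'] := a_div s s0; first by exists h.
have bU : b \is a GRing.unit.
  by apply: contrapT => /negP bN; apply: s_irr; exists a, b.
by apply: aS; rewrite -(mulrK bU a) -sE' mulrC; apply: S_unit; rewrite ?unitrV.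
Qed.

Lemma conservative_unit_closed : unit_closed (phi @` S).
Proof.
move=> _ _ /conservative_unit_lift[u uU ->] [s Ss <-].
by exists (u * s); [exact: S_unit|rewrite rmorphM].
Qed.

End Conservative.

Lemma conservative_id (A : idomainType) (S : set A) :
  conservative (idfun : {rmorphism A -> A}) S.
Proof. by split=> // g; left; exists g. Qed.

(** An element [g] of [C] gets its witness from [B] if possible; that witness is
    an element [b] of [B], and either [b] comes from [A] or the witness of [b]
    is also one for [g]. *)
Lemma conservative_comp (A B C : idomainType) (phi : {rmorphism A -> B})
    (psi : {rmorphism B -> C}) (S : set A) :
  conservative phi S -> conservative psi (phi @` S) ->
  conservative (psi \o phi) S.
Proof.
move=> phi_cons psi_cons.
have [phi_div phi_lift] := phi_cons; have [psi_div psi_lift] := psi_cons.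
split=> [x y /psi_div/phi_div//|g].
have [[g' gE]|[b [bN bS b_div]]] := psi_lift g.
  have [[x g'E]|[a [aN aS a_div]]] := phi_lift g'.
    by left; exists x; rewrite gE g'E.
  right; exists a; split=> // c c0; rewrite gE => /psi_div; exact: a_div.
have gb c : c != 0 -> divides g ((psi \o phi) c) -> divides b (phi c).
  move=> c0; apply: b_div; rewrite raddf_eq0 //.
  exact: conservative_inj phi_cons.
right; have [[x bE]|[a [aN aS a_div]]] := phi_lift b.
  exists x; split=> [||c c0 /(gb c c0)]; last by rewrite bE; exact: phi_div.
    by apply: contra bN => xU; rewrite bE rmorph_unit.
  by move=> Sx; apply: bS; exists x.
by exists a; split=> // c c0 /(gb c c0); exact: a_div.
Qed.

(** * Domains with classical inverses *)

(** The signature of an integral domain includes a unit test and an inverse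
    function, which excluded middle and choice provide. *)
Section ClassicalDomain.
Variables (R : comNzRingType) (R_domain : GRing.integral_domain_axiom R).

Let unit : pred R := fun x => `[< exists y, y * x = 1 >].
Let inv (x : R) : R :=
  if pselect (exists y, y * x = 1) is left h then projT1 (cid h) else x.

Let mulVx : {in unit, left_inverse 1 inv *%R}.
Proof. by rewrite /inv => x /asboolP ux; case: pselect => // h; case: cid. Qed.

Let unitPl x y : y * x = 1 -> unit x.
Proof. by move=> yx1; apply/asboolP; exists y. Qed.

Let invr_out : {in [predC unit], inv =1 id}.
Proof. by rewrite /inv => x /asboolP nux; case: pselect. Qed.

Let unit_ring : comUnitRingType :=
  HB.pack (GRing.ComNzRing.sort R)
    (GRing.ComNzRing_hasMulInverse.Build R mulVx unitPl invr_out).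

Definition domain_of : idomainType :=
  HB.pack (GRing.ComNzRing.sort R) (GRing.ComUnitRing.class unit_ring)
    (GRing.ComUnitRing_isIntegral.Build unit_ring R_domain).
End ClassicalDomain.

(** * Convolution of functions on an abelian group *)

Section Convolution.
Variables (D : idomainType) (G : zmodType).
Implicit Types (f g h : G -> D) (x y z : G) (A : {fset G}).

Definition supp f : set G := [set x | f x != 0].

(** The product of the group algebra, for finitely supported functions.  A sum
    with infinitely many nonzero terms has the value [0]. *)
Definition conv f g : G -> D := fun x => \sum_(y \in [set: G]) f y * g (x - y).

Definition mono x (c : D) : G -> D := fun y => if y == x then c else 0.

Lemma finite_supp_bound f :
  finite_set (supp f) -> exists A, forall x, x \notin A -> f x = 0.
Proof.
move=> /finite_fsetP[A fA]; exists A => x; apply: contraNeq => fx.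
by have : supp f x by []; rewrite fA.
Qed.

Lemma finite_supp_mono x c : finite_set (supp (mono x c)).
Proof.
apply: (sub_finite_set _ (finite_set1 x)) => y.
by rewrite /supp /mono /=; case: (eqVneq y x) => //; rewrite eqxx.
Qed.

Lemma convE A f g x : (forall y, y \notin A -> f y = 0) ->
  conv f g x = \sum_(y <- A) f y * g (x - y).
Proof. by move=> fA; apply: fsbigTE => y /fA ->; rewrite mul0r. Qed.

Lemma convC f g : conv f g = conv g f.
Proof.
apply/funext => x; rewrite /conv (reindex_fsbigT (fun y => x - y)).
  by apply: eq_fsbigr => y _; rewrite mulrC subKr.
by exists (fun y => x - y) => y; rewrite subKr.
Qed.

Lemma conv_monol x c f y : conv (mono x c) f y = c * f (y - x).
Proof.
rewrite (@convE [fset x]%fset) ?big_seq_fset1 /mono ?eqxx // => z.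
by rewrite inE => /negbTE ->.
Qed.

Lemma conv_mono x y c d : conv (mono x c) (mono y d) = mono (x + y) (c * d).
Proof.
apply/funext => z; rewrite conv_monol /mono subr_eq addrC.
by case: eqP; rewrite ?mulr0.
Qed.

Lemma convDl f g h : finite_set (supp h) ->
  conv (f + g) h = conv f h + conv g h.
Proof.
move=> /finite_supp_bound[A hA]; apply/funext => x.
rewrite [RHS]/GRing.add/= ![conv _ h]convC !(convE _ _ hA) -big_split.
by apply: eq_bigr => y _ /=; rewrite -mulrDr.
Qed.

(** After using commutativity inside, both sides are the sum over [y] and [z] of
    [f y * h z * g (x - y - z)], taken in the two possible orders. *)
Lemma convA f g h : finite_set (supp f) -> finite_set (supp h) ->
  conv f (conv g h) = conv (conv f g) h.
Proof.
move=> /finite_supp_bound[A fA] /finite_supp_bound[B hB]; apply/funext => x.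
rewrite (convC (conv f g)) (convE _ _ fA) (convE _ _ hB).
under eq_bigr do rewrite convC (convE _ _ hB) big_distrr.
under [RHS]eq_bigr do rewrite (convE _ _ fA) big_distrr.
rewrite exchange_big; apply: eq_bigr => y _; apply: eq_bigr => z _ /=.
by rewrite mulrCA addrAC.
Qed.

Lemma supp_conv f g x : supp (conv f g) x ->
  exists y z, [/\ x = y + z, supp f y & supp g z].
Proof.
move=> /(@fsbigN1 _ _ _ G G _ (fun x y => f y * g (x - y)))[y _].
rewrite mulf_eq0 negb_or => /andP[fy gz].
by exists y, (x - y); rewrite subrKC.
Qed.

Lemma finite_supp_conv f g :
  finite_set (supp f) -> finite_set (supp g) -> finite_set (supp (conv f g)).
Proof.
move=> fin_f fin_g.
apply: (sub_finite_set _ (finite_image2 +%R fin_f fin_g)) => x.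
by move=> /supp_conv[y [z [-> fy gz]]]; exists y => //; exists z.
Qed.

(** The augmentation of the group algebra, sending every group element
    to [1]. *)
Definition augment f : D := \sum_(x \in [set: G]) f x.

Lemma augmentE A f : (forall y, y \notin A -> f y = 0) ->
  augment f = \sum_(y <- A) f y.
Proof. exact: fsbigTE. Qed.

Lemma augment_mono x c : augment (mono x c) = c.
Proof.
rewrite (@augmentE [fset x]%fset) ?big_seq_fset1 /mono ?eqxx // => z.
by rewrite inE => /negbTE ->.
Qed.

Lemma augmentB f g : finite_set (supp f) -> finite_set (supp g) ->
  augment (f - g) = augment f - augment g.
Proof.
move=> /finite_supp_bound[A fA] /finite_supp_bound[B gB].
have fAB y : y \notin (A `|` B)%fset -> f y = 0.
  by rewrite inE negb_or => /andP[/fA].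
have gAB y : y \notin (A `|` B)%fset -> g y = 0.
  by rewrite inE negb_or => /andP[_ /gB].
rewrite (augmentE fAB) (augmentE gAB) (@augmentE (A `|` B)%fset) ?sumrB //.
by move=> y yAB; rewrite /GRing.add /GRing.opp /= fAB ?gAB // subrr.
Qed.

Lemma augment_conv f g : finite_set (supp f) -> finite_set (supp g) ->
  augment (conv f g) = augment f * augment g.
Proof.
move=> fin_f fin_g; have [A fA] := finite_supp_bound fin_f.
have [B gB] := finite_supp_bound fin_g.
have shift y : augment (fun x => g (x - y)) = augment g.
  rewrite /augment [RHS](reindex_fsbigT (fun x => x - y)) //.
  by exists (fun x => x + y) => x; rewrite (addrK, subrK).
pose C := [fset (y + z)%R | y in A, z in B]%fset.
have fgC x y : y \in A -> x \notin C -> g (x - y) = 0.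
  move=> yA; apply: contraNeq => gxy; apply/imfset2P; exists y => //.
  exists (x - y); last by rewrite subrKC.
  by apply: contraNT gxy => /gB ->.
rewrite (augmentE fA) mulr_suml (@augmentE C); last first.
  move=> x xC; rewrite (convE _ _ fA) big_seq big1 // => y yA.
  by rewrite fgC ?mulr0.
under eq_bigr do rewrite (convE _ _ fA).
rewrite exchange_big /= big_seq [RHS]big_seq; apply: eq_bigr => y yA.
by rewrite -mulr_sumr -(shift y) (@augmentE C) // => x; exact: fgC.
Qed.

End Convolution.

Lemma mono_index_inj (D : idomainType) (G : zmodType) (x y : G) (c d : D) :
  c != 0 -> mono x c = mono y d -> x = y.
Proof.
move=> c0 /(congr1 (@^~ x)); rewrite /mono eqxx.
by case: eqP => // _ cd; rewrite cd eqxx in c0.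
Qed.

(** * Leading terms over an orderable group *)

(** A total order compatible with the addition, given by its set of positive
    elements. *)
Definition positive_cone (G : zmodType) (P : set G) : Prop :=
  [/\ ~ P 0, forall x y, P x -> P y -> P (x + y)
    & forall x, x != 0 -> P x \/ P (- x)].

Definition orderable (G : zmodType) : Prop := exists P : set G, positive_cone P.

Lemma positive_coneN (G : zmodType) (P : set G) :
  positive_cone P -> positive_cone [set x | P (- x)].
Proof.
move=> [P0 PD PV]; split=> [|x y Px Py|x xN0] /=; first by rewrite oppr0.
  by rewrite opprD; exact: PD.
by rewrite opprK; case: (PV x xN0); [right|left].
Qed.

(** A well-order on [T] makes the lexicographic order total on all functions,
    whatever their supports: two distinct functions have a least argument at
    which they differ. *)
Lemma orderable_int_fun (T : eqType) : orderable (T -> int).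
Proof.
have [R R_wo] := well_ordering_principle T.
have R_wo_chain : wo_chain R (predT : {pred T}) by move=> A _; exact: R_wo.
have R_total x y : R x y \/ R y x.
  by apply/orP; exact: wo_chainW R_wo_chain _ _ _ _.
have R_anti x y : R x y -> R y x -> x = y.
  by move=> ? ?; apply: (wo_chain_antisymmetric R_wo_chain) => //; exact/andP.
have R_trans x y z : R x y -> R y z -> R x z.
  move=> Rxy Ryz; have [//|Rzx] := R_total x z.
  have [|m [[]]] := R_wo (mem [:: x; y; z]); first by exists x; exact: mem_head.
  rewrite !inE => /or3P[] /eqP-> m_min _.
    by apply: m_min; rewrite !inE eqxx !orbT.
    by rewrite (R_anti x y) //; apply: m_min; rewrite !inE eqxx.
  by rewrite -(R_anti y z) // m_min ?inE ?eqxx ?orbT.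
pose lex_pos (g : T -> int) t :=
  0 < g t /\ forall s, R s t -> s != t -> g s = 0.
have lex_posD g h t u :
    R t u -> lex_pos g t -> lex_pos h u -> lex_pos (g + h) t.
  move=> Rtu [gt0 gt] [hu0 hu]; split=> [|s Rst s_t].
    rewrite /GRing.add /= ltr_wpDr //.
    by have [->|/hu->//] := eqVneq t u; exact: ltW.
  rewrite /GRing.add /= gt // hu ?addr0 //; first exact: R_trans Rtu.
  by apply: contraNneq s_t => su; rewrite su (R_anti t u) // -su.
exists [set g | exists t, lex_pos g t].
split=> [[t []]|g h [t gt] [u hu]|g g0] //=.
  have [tu|ut] := R_total t u; first by exists t; exact: lex_posD tu gt hu.
  by exists u; rewrite addrC; exact: lex_posD ut hu gt.
have /R_wo[t [[gt t_min] _]] : nonempty [pred t | g t != 0].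
  apply: contrapT => /forallNP g_eq0; case/eqP: g0; apply/funext => t.
  by apply/eqP/negPn/negP; exact: g_eq0.
have g_below s : R s t -> s != t -> g s = 0.
  move=> Rst; apply: contraNeq => gs.
  by apply/eqP; apply: R_anti => //; exact: t_min.
move: gt; rewrite inE neq_lt => /orP[gt|gt]; [right|left]; exists t; split=> //.
  by rewrite /GRing.opp /= oppr_gt0.
by move=> s Rst s_t; rewrite /GRing.opp /= g_below ?oppr0.
Qed.

Section LeadingTerm.
Variables (D : idomainType) (G : zmodType).
Implicit Types (f g : G -> D) (x y z m n : G) (P : set G).

(** [m] is the largest element of the support of [f] for the order with positive
    cone [P]; applied to the opposite cone, it is the smallest. *)
Definition leading P f m :=
  supp f m /\ forall x, supp f x -> x = m \/ P (m - x).

Lemma exists_leading P f : positive_cone P -> finite_set (supp f) -> f != 0 ->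
  exists m, leading P f m.
Proof.
move=> [P0 PD PV] /finite_fsetP[A fA] f0.
have in_supp x : supp f x = (x \in A) by rewrite fA.
suff lead (s : seq G) : s != [::] ->
    exists m, m \in s /\ forall x, x \in s -> x = m \/ P (m - x).
  have [|m [mA m_max]] := lead (enum_fset A).
    apply: contra_neq f0 => A0; apply/funext => x.
    apply/eqP/negPn/negP => fx.
    have : x \in enum_fset A by have : supp f x by []; rewrite in_supp.
    by rewrite A0.
  exists m; split=> [|x]; first by rewrite in_supp.
  by rewrite in_supp; exact: m_max.
elim: s => // x s IHs _; have [->|/IHs[m [ms m_max]]] := eqVneq s [::].
  by exists x; split=> [|y]; rewrite inE ?eqxx // => /eqP ->; left.
have [->|xm] := eqVneq x m.
  exists m; rewrite mem_head; split=> // y.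
  rewrite inE => /orP[/eqP->|/m_max//].
  by left.
have [Pmx|Pxm] : P (m - x) \/ P (x - m).
- by rewrite -(opprB m); apply: PV; rewrite subr_eq0 eq_sym.
- exists m; rewrite inE ms orbT; split=> // y; rewrite inE.
  by move=> /orP[/eqP->|/m_max//]; right.
exists x; rewrite mem_head; split=> // y; rewrite inE => /orP[/eqP->|/m_max].
  by left.
by move=> [->|Pmy]; right => //; rewrite -(subrKA m); exact: PD.
Qed.

(** The only way to write [m + n] as a sum of elements of the two supports is
    [m] plus [n]. *)
Lemma conv_leading P f g m n : positive_cone P -> finite_set (supp f) ->
  leading P f m -> leading P g n -> conv f g (m + n) = f m * g n.
Proof.
move=> [P0 PD PV] /finite_supp_bound[A fA] [fm f_lead] [gn g_lead].
have mA : m \in A by apply: contraT => /fA fm0; rewrite /supp /= fm0 eqxx in fm.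
rewrite (convE _ _ fA) (bigD1_seq m) ?fset_uniq //= big1 ?addr0 => [|x xm].
  by rewrite addrC addKr.
apply/eqP; rewrite mulf_eq0 -implyNb; apply/implyP => fx.
apply/negPn/negP => gx; case: (f_lead x fx) => [/eqP|Pmx]; first exact/negP.
have : supp g (m + n - x) by [].
case/g_lead => [/eqP|].
  by rewrite subr_eq addrC (inj_eq (addrI n)) eq_sym (negbTE xm).
rewrite addrAC [_ - x + n]addrC opprD addNKr => /PD /(_ Pmx).
by rewrite addNr.
Qed.

Lemma conv_neq0 f g : orderable G -> finite_set (supp f) ->
  finite_set (supp g) -> f != 0 -> g != 0 -> conv f g != 0.
Proof.
move=> [P P_cone] fin_f fin_g f0 g0.
have [m fm] := exists_leading P_cone fin_f f0.
have [n gn] := exists_leading P_cone fin_g g0.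
apply: contra_notN (negP (mulf_neq0 fm.1 gn.1)) => /eqP fg0.
by rewrite -(conv_leading P_cone fin_f fm gn) fg0.
Qed.

(** Let [m] and [m'] be the largest and the smallest element of the support of
    [f], and [n] and [n'] those of [g].  The coefficients of the product at
    [m + n] and [m' + n'] are nonzero, so [m + n = z = m' + n'], which forces
    [m = m'] and [n = n']. *)
Lemma conv_eq_mono f g z c : orderable G -> finite_set (supp f) ->
  finite_set (supp g) -> c != 0 -> conv f g = mono z c ->
  exists x y, [/\ f = mono x (f x), g = mono y (g y), x + y = z
                & f x * g y = c].
Proof.
move=> [P P_cone] fin_f fin_g c0 fg.
have [P0 PD _] := P_cone; have PN_cone := positive_coneN P_cone.
have fg0 : conv f g != 0.
  apply: contra_neq c0 => fg0.
  by have := congr1 (@^~ z) fg; rewrite fg0 /mono eqxx.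
have f0 : f != 0.
  apply: contra_neq fg0 => ->; apply/funext => x.
  by rewrite /conv fsbig1 // => y _; rewrite mul0r.
have g0 : g != 0.
  apply: contra_neq fg0 => ->; apply/funext => x.
  by rewrite /conv fsbig1 // => y _; rewrite mulr0.
have top_eq Q : positive_cone Q -> forall m n, leading Q f m -> leading Q g n ->
    m + n = z /\ f m * g n = c.
  move=> Q_cone m n fm gn; have := conv_leading Q_cone fin_f fm gn.
  rewrite fg /mono; case: eqP => [-> ->//|_ /esym/eqP].
  by rewrite mulf_eq0 (negbTE fm.1) (negbTE gn.1).
have [m fm] := exists_leading P_cone fin_f f0.
have [n gn] := exists_leading P_cone fin_g g0.
have [m' fm'] := exists_leading PN_cone fin_f f0.
have [n' gn'] := exists_leading PN_cone fin_g g0.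
have [mn fgmn] := top_eq _ P_cone _ _ fm gn.
have [mn' _] := top_eq _ PN_cone _ _ fm' gn'.
have mn'E : n - n' = m' - m.
  rewrite -(addKr m n) -(addKr m' n') mn mn' opprD opprK.
  by rewrite addrACA subrr addr0 addrC.
have m'E : m' = m.
  case: (fm.2 _ fm'.1) => // Pm; case: (gn.2 _ gn'.1) => [n'E|].
    by apply/eqP; rewrite -subr_eq0 -mn'E n'E subrr.
  by rewrite mn'E => /PD /(_ Pm); rewrite subrKA subrr.
have n'E : n' = n.
  by apply/eqP; rewrite eq_sym -subr_eq0 mn'E m'E subrr.
have supp1 h k :
    leading P h k -> leading [set x | P (- x)] h k -> h = mono k (h k).
  move=> hk hk'; apply/funext => x; rewrite /mono; case: eqP => [->//|xk].
  apply/eqP/negPn/negP => hx; case: (hk.2 x hx) => // Pkx.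
  by case: (hk'.2 x hx) => // /(PD _ _ Pkx); rewrite subrr.
exists m, n; split=> //; first by apply: supp1 => //; rewrite -m'E.
by apply: supp1 => //; rewrite -n'E.
Qed.

End LeadingTerm.

(** * Graded domains *)

(** Ideals [component x] of [D] indexed by the group, such that the elements of
    the group algebra with coefficients in them form a ring containing [D] in
    degree [0].  Closure under multiplication by [D] is the case [x = 0] of
    [componentM]. *)
Record component_family (D : idomainType) (G : zmodType) := ComponentFamily {
  component :> G -> set D;
  component0 : forall x, component x 0;
  componentB : forall x c d,
    component x c -> component x d -> component x (c - d);
  componentM : forall x y c d,
    component x c -> component y d -> component (x + y) (c * d);
  component_const : forall c, component 0 c }.

Section GradedRing.
Variables (D : idomainType) (G : zmodType) (I : component_family D G).
Implicit Types (x y z : G) (c d : D).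

Definition graded_pred : {pred G -> D} :=
  fun f => `[< finite_set (supp f) /\ forall x, I x (f x) >].

Lemma graded_zmod_closed : zmod_closed graded_pred.
Proof.
split=> [|f g /asboolP[fin_f If] /asboolP[fin_g Ig]]; apply/asboolP; split.
- by apply: (sub_finite_set _ (@finite_set0 _)) => x; rewrite /supp /= eqxx.
- by move=> x; exact: component0.
- have : finite_set (supp f `|` supp g) by rewrite finite_setU.
  apply: sub_finite_set => x; rewrite /supp /= => fgx.
  have [f0|] := eqVneq (f x) 0; [right|by left].
  by apply: contraNneq fgx => g0; rewrite /GRing.add /GRing.opp /= f0 g0 subrr.
- by move=> x; exact: componentB.
Qed.

HB.instance Definition _ := GRing.isZmodClosed.Build (G -> D) graded_pred
  graded_zmod_closed.

Record graded :=
  Graded { graded_val :> G -> D; _ : graded_val \in graded_pred }.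

HB.instance Definition _ := [isSub for graded_val].
HB.instance Definition _ := [Choice of graded by <:].
HB.instance Definition _ := [SubChoice_isSubZmodule of graded by <:].

Implicit Types f g h : graded.

Lemma graded_finite f : finite_set (supp f).
Proof. by case: f => f /= /asboolP[]. Qed.

Lemma graded_component f x : I x (f x).
Proof. by case: f => f /= /asboolP[]. Qed.

Lemma graded_inj f g : graded_val f = graded_val g -> f = g.
Proof. exact: val_inj. Qed.

Lemma conv_graded f g : conv f g \in graded_pred.
Proof.
apply/asboolP; split.
  exact: finite_supp_conv (graded_finite f) (graded_finite g).
move=> x; have [A fA] := finite_supp_bound (graded_finite f).
have ID c d : I x c -> I x d -> I x (c + d).
  move=> Ic Id; rewrite -[d]opprK -[- d]sub0r.
  by do 2![apply: componentB => //]; exact: component0.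
rewrite (convE _ _ fA); apply: big_ind => //; first exact: component0.
move=> y _; rewrite -{1}(subrKC y x).
by apply: componentM; exact: graded_component.
Qed.

Lemma mono_graded x c : I x c -> mono x c \in graded_pred.
Proof.
move=> Ic; apply/asboolP; split=> [|y]; first exact: finite_supp_mono.
by rewrite /mono; case: eqP => [->//|_]; exact: component0.
Qed.

(** The monomial [c X^x]. *)
Definition gmono x c (Ic : I x c) : graded := Graded (mono_graded Ic).

Definition gconst c : graded := gmono (component_const I c).
Definition gmul f g : graded := Graded (conv_graded f g).

Let gmulA : associative gmul.
Proof.
by move=> f g h; apply: graded_inj; apply: convA; exact: graded_finite.
Qed.

Let gmulC : commutative gmul.
Proof. by move=> f g; apply: graded_inj; exact: convC. Qed.

Let gmul1 : left_id (gconst 1) gmul.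
Proof.
move=> f; apply: graded_inj; apply/funext => x /=.
by rewrite conv_monol mul1r subr0.
Qed.

Let gmulDl : left_distributive gmul +%R.
Proof.
by move=> f g h; apply: graded_inj; apply: convDl; exact: graded_finite.
Qed.

Let gone_neq0 : gconst 1 != 0.
Proof.
apply/eqP => /(congr1 (fun f : graded => f 0)) /= /eqP.
by rewrite /mono eqxx oner_eq0.
Qed.

HB.instance Definition _ :=
  GRing.Zmodule_isComNzRing.Build graded gmulA gmulC gmul1 gmulDl gone_neq0.

Lemma gmulE f g : (f * g : graded) = conv f g :> (G -> D). Proof. by []. Qed.

Let gconst_zmod_morphism : zmod_morphism gconst.
Proof.
move=> c d; apply: graded_inj; apply/funext => x; rewrite /= /mono.
by rewrite /GRing.add /GRing.opp /=; case: eqP => //; rewrite subrr.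
Qed.

Let gconst_monoid_morphism : monoid_morphism gconst.
Proof.
by split=> // c d; apply: graded_inj; rewrite gmulE /= conv_mono addr0.
Qed.

HB.instance Definition _ :=
  GRing.isZmodMorphism.Build D graded gconst gconst_zmod_morphism.
HB.instance Definition _ :=
  GRing.isMonoidMorphism.Build D graded gconst gconst_monoid_morphism.

Definition gaugment f : D := augment f.

Let gaugment_zmod_morphism : zmod_morphism gaugment.
Proof. by move=> f g; apply: augmentB; exact: graded_finite. Qed.

Let gaugment_monoid_morphism : monoid_morphism gaugment.
Proof.
split; first exact: augment_mono.
by move=> f g; apply: augment_conv; exact: graded_finite.
Qed.

HB.instance Definition _ :=
  GRing.isZmodMorphism.Build graded D gaugment gaugment_zmod_morphism.
HB.instance Definition _ :=
  GRing.isMonoidMorphism.Build graded D gaugment gaugment_monoid_morphism.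

Lemma gconstK : cancel gconst gaugment.
Proof. by move=> c; exact: augment_mono. Qed.

Hypothesis G_orderable : orderable G.

Lemma graded_domain_axiom : GRing.integral_domain_axiom graded.
Proof.
move=> f g fg0; apply/norP => -[f0 g0].
have /eqP[] : conv f g != 0.
  by apply: conv_neq0 => //; exact: graded_finite.
by rewrite -gmulE fg0.
Qed.

Definition graded_domain : idomainType := domain_of graded_domain_axiom.

End GradedRing.

(** If [g * h] is a nonzero constant [c], then [g = d X^x] and [h = d' X^(- x)]
    with [c = d * d'].  The exponent [x] depends on [g] only; for [x = 0] the
    element [g] is a constant, and for the other [x] a common divisor [a] of the
    products of elements of [I x] and [I (- x)] is a witness. *)
Lemma gconst_conservative (D : idomainType) (G : zmodType)
    (I : component_family D G) (G_orderable : orderable G) (S : set D) :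
  ~ S 0 ->
  (forall x, x != 0 -> exists a, [/\ a \isn't a GRing.unit, ~ S a
    & forall c d, I x c -> I (- x) d -> divides a (c * d)]) ->
  conservative (@gconst D G I : {rmorphism D -> graded_domain I G_orderable}) S.
Proof.
move=> S0 I_div; split=> [x y [h yE]|g].
  exists (h 0); have := congr1 (fun f : graded I => f 0) yE.
  by rewrite gmulE /= conv_monol subr0 /mono eqxx.
pose gdiv c x := [/\ c != 0, (g : graded I) = mono x (g x) :> (G -> D)
  & exists d, I (- x) d /\ c = g x * d].
have divP c : c != 0 -> divides g (gconst I c : graded_domain I G_orderable) ->
    exists x, gdiv c x.
  move=> c0 [h gh].
  have {}gh : conv (g : graded I) (h : graded I) = mono 0 c.
    exact: (esym (congr1 (@graded_val _ _ I) gh)).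
  have [x [y [gE hE xy0 ghc]]] := conv_eq_mono G_orderable
    (graded_finite (g : graded I)) (graded_finite (h : graded I)) c0 gh.
  exists x; split=> //; exists (h y); split=> //.
  have <- : y = - x by apply/eqP; rewrite -addr_eq0 addrC xy0.
  exact: graded_component.
have [[c [x [c0 gE [d [Id cE]]]]]|none] := pselect (exists c x, gdiv c x);
  last first.
  (* Here [g] divides no nonzero constant. *)
  right; exists 0; rewrite unitr0; split=> // c c0 /(divP c c0)[x gcx].
  by case: none; exists c, x.
have gx0 : g x != 0 by apply: contraNneq c0 => gx0; rewrite cE gx0 mul0r.
have [x0|/I_div[a [aN aS a_div]]] := eqVneq x 0.
  by left; exists (g 0); apply: graded_inj; rewrite x0 in gE; exact: gE.
right; exists a; split=> // c' c'0 /(divP c' c'0)[x' [_ gE' [d' [Id' ->]]]].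
have xx' : x = x'.
  by apply/eqP; apply: contraNT gx0 => xx'; rewrite gE' /mono (negbTE xx') eqxx.
by rewrite -xx' in Id' *; apply: a_div => //; exact: graded_component.
Qed.

(** * Splitting the atoms outside a set *)

Section Splitting.
Variables (D : idomainType) (S : set D).

(** Every element of [D] gets a variable, so that exponents are functions on all
    of [D]; the weight [0] excludes the negative powers of the variables that
    belong to no atom to be split. *)
Definition split_weight (a : D) : D :=
  if `[< atom a /\ ~ S a >] then a else 0.

Definition neg_part (m : int) : nat := if m is Negz n then n.+1 else 0%N.

(** This adjunction reduces subadditivity of the negative part to the addition
    of two inequalities. *)
Lemma neg_part_le m k : (neg_part m <= k)%N = (- k%:Z <= m).
Proof. by case: m => n /=; lia. Qed.

Lemma neg_partD m n : (neg_part (m + n) <= neg_part m + neg_part n)%N.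
Proof.
rewrite neg_part_le PoszD opprD lerD // -neg_part_le; exact: leqnn.
Qed.

(** The condition under which [c X^x] belongs to the ring: each negative power
    [X_a ^ (- n)] needs a factor [a ^ n] in the coefficient.  Stated separately
    for each [a], it makes sense for exponents [x] of infinite support. *)
Definition split_component (x : D -> int) : set D :=
  [set c | forall a, divides (split_weight a ^+ neg_part (x a)) c].

Lemma split_component0 x : split_component x 0.
Proof. by move=> a; exists 0; rewrite mulr0. Qed.

Lemma split_componentB x c d :
  split_component x c -> split_component x d -> split_component x (c - d).
Proof.
move=> Ic Id a; have [[u ->] [v ->]] := (Ic a, Id a).
by exists (u - v); rewrite mulrBr.
Qed.

Lemma split_componentM x y c d :
  split_component x c -> split_component y d -> split_component (x + y) (c * d).
Proof.
move=> Ic Id a; have [[u ->] [v ->]] := (Ic a, Id a); rewrite mulrACA -exprD.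
by rewrite -(subnKC (neg_partD (x a) (y a))) exprD -!mulrA; eexists.
Qed.

Lemma split_component_const c : split_component 0 c.
Proof. by move=> a; exists c; rewrite mul1r. Qed.

Definition split_family := ComponentFamily split_component0 split_componentB
  split_componentM split_component_const.

Definition split_domain : idomainType :=
  graded_domain split_family (orderable_int_fun D).

Definition split_inj : {rmorphism D -> split_domain} :=
  @gconst D _ split_family.

Definition split_retract : {rmorphism split_domain -> D} :=
  @gaugment D _ split_family.

Lemma split_injK : cancel split_inj split_retract.
Proof. exact: gconstK. Qed.

Hypothesis S_atoms : S `<=` atoms D.

Lemma split_weightN a :
  split_weight a \isn't a GRing.unit /\ ~ S (split_weight a).
Proof.
rewrite /split_weight; case: asboolP => [[[_ aN _] aS]//|_].
by rewrite unitr0; split=> //; exact: atoms_neq0.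
Qed.

(** If [x a] is nonzero, then [a] has a negative exponent in [x] or in [- x],
    and there all the coefficients are multiples of the weight of [a]. *)
Lemma split_conservative : conservative split_inj S.
Proof.
apply: gconst_conservative; first exact: atoms_neq0.
move=> x x0; have [a xa] : exists a, x a != 0.
  apply: contrapT => /forallNP x_eq0; case/eqP: x0; apply/funext => a.
  by apply/eqP/negPn/negP; exact: x_eq0.
have [wN wS] := split_weightN a; exists (split_weight a); split=> // c d Ic Id.
have w_div y e : (0 < neg_part (y a))%N -> split_component y e ->
    divides (split_weight a) e.
  move=> ya /(_ a); apply: divides_trans.
  by rewrite -(prednK ya) exprS; eexists.
have [xa_neg|xa_pos] : (0 < neg_part (x a))%N \/ (0 < neg_part (- x a))%N.
- by case: (x a) xa => [[|n]|n] //=; [right|left].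
- by apply: dividesMr; exact: w_div Ic.
by apply: dividesMl; exact: w_div Id.
Qed.

(** The factorization is [a = X_a * (a / X_a)]; neither factor is a unit,
    because units of the extension are constants. *)
Lemma split_not_atom a : atom a -> ~ S a -> ~ atom (split_inj a).
Proof.
move=> a_atom aS [_ _]; apply.
have wa : split_weight a = a by rewrite /split_weight asboolT.
pose delta : D -> int := fun b => if b == a then 1 else 0.
have I_delta : split_family delta 1.
  by move=> b; exists 1; rewrite /delta; case: eqP => _; rewrite expr0 mul1r.
have I_Ndelta : split_family (- delta) a.
  move=> b; rewrite /GRing.opp /= /delta; case: eqP => [->|_] /=.
    by rewrite wa; exact: dividesxx.
  by exists a; rewrite mul1r.
have delta0 : delta != 0.
  by apply/eqP => /(congr1 (@^~ a)); rewrite /delta eqxx.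
have a0 : a != 0 by case: a_atom.
exists (gmono I_delta : split_domain), (gmono I_Ndelta : split_domain); split.
- apply/negP => /(conservative_unit_lift split_conservative)[u _ uE].
  have /mono_index_inj deltaE := congr1 (@graded_val _ _ split_family) uE.
  by rewrite deltaE ?oner_neq0 ?eqxx in delta0.
- apply/negP => /(conservative_unit_lift split_conservative)[u _ uE].
  have /mono_index_inj deltaE := congr1 (@graded_val _ _ split_family) uE.
  by rewrite -oppr_eq0 deltaE ?eqxx in delta0.
apply: (@graded_inj D _ split_family); rewrite [RHS]gmulE /= conv_mono.
by rewrite subrr mul1r.
Qed.

End Splitting.

(** * Direct limits of domains *)

(** The union of a chain [R 0 -> R 1 -> R 2 -> ...] is realized inside the
    product of all the [R n].  Given retractions [rho n] of the embeddings
    [phi n], an element of the union is represented by the sequence that is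
    compatible with the [rho n] everywhere and with the [phi n] from some index
    on.  Such a
    sequence is determined by any of its late enough terms, so distinct
    sequences represent distinct elements. *)
Section ProductRing.
Variable R : nat -> idomainType.

Definition prod_ring : Type := forall n, R n.

HB.instance Definition _ := Choice.on prod_ring.

Implicit Types f g h : prod_ring.

Let dfunext f g : (forall n, f n = g n) -> f = g.
Proof. exact: functional_extensionality_dep. Qed.

Let add f g : prod_ring := fun n => f n + g n.
Let opp f : prod_ring := fun n => - f n.
Let mul f g : prod_ring := fun n => f n * g n.
Let zero : prod_ring := fun n => 0.
Let one : prod_ring := fun n => 1.

Let addA : associative add.
Proof. by move=> f g h; apply: dfunext => n; exact: addrA. Qed.
Let addC : commutative add.
Proof. by move=> f g; apply: dfunext => n; exact: addrC. Qed.
Let add0 : left_id zero add.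
Proof. by move=> f; apply: dfunext => n; exact: add0r. Qed.
Let addN : left_inverse zero opp add.
Proof. by move=> f; apply: dfunext => n; exact: addNr. Qed.

HB.instance Definition _ := GRing.isZmodule.Build prod_ring addA addC add0 addN.

Let mulA : associative mul.
Proof. by move=> f g h; apply: dfunext => n; exact: mulrA. Qed.
Let mulC : commutative mul.
Proof. by move=> f g; apply: dfunext => n; exact: mulrC. Qed.
Let mul1 : left_id one mul.
Proof. by move=> f; apply: dfunext => n; exact: mul1r. Qed.
Let mulD : left_distributive mul +%R.
Proof. by move=> f g h; apply: dfunext => n; exact: mulrDl. Qed.
Let one_neq0 : one != zero.
Proof. by apply/eqP => /(congr1 (@^~ 0%N))/eqP; rewrite oner_eq0. Qed.

HB.instance Definition _ :=
  GRing.Zmodule_isComNzRing.Build prod_ring mulA mulC mul1 mulD one_neq0.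

End ProductRing.

Section Tower.
Variables (R : nat -> idomainType) (phi : forall n, {rmorphism R n -> R n.+1})
  (rho : forall n, {rmorphism R n.+1 -> R n}).

Definition retracting (f : forall n, R n) := forall n, rho n (f n.+1) = f n.

Definition coherent_from N (f : forall n, R n) :=
  forall n, (N <= n)%N -> f n.+1 = phi n (f n).

Definition limit_pred : {pred prod_ring R} :=
  fun f => `[< retracting f /\ exists N, coherent_from N f >].

Lemma limit_subring_closed : subring_closed limit_pred.
Proof.
split=> [|f g|f g].
- apply/asboolP; split=> [n|]; first exact: rmorph1.
  by exists 0%N => n _; rewrite rmorph1.
- move=> /asboolP[rf [M cf]] /asboolP[rg [N cg]]; apply/asboolP; split=> [n|].
    by rewrite -[_ - _]/(fun n => f n - g n) /= rmorphB rf rg.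
  exists (maxn M N) => n; rewrite geq_max => /andP[Mn Nn].
  by rewrite -[_ - _]/(fun n => f n - g n) /= cf // cg // rmorphB.
- move=> /asboolP[rf [M cf]] /asboolP[rg [N cg]]; apply/asboolP; split=> [n|].
    by rewrite -[_ * _]/(fun n => f n * g n) /= rmorphM rf rg.
  exists (maxn M N) => n; rewrite geq_max => /andP[Mn Nn].
  by rewrite -[_ * _]/(fun n => f n * g n) /= cf // cg // rmorphM.
Qed.

HB.instance Definition _ := GRing.isSubringClosed.Build (prod_ring R) limit_pred
  limit_subring_closed.

Record limit := Limit { limit_val : prod_ring R; _ : limit_val \in limit_pred }.

Definition coord (f : limit) : forall n, R n := limit_val f.
Coercion coord : limit >-> Funclass.

HB.instance Definition _ := [isSub for limit_val].
HB.instance Definition _ := [Choice of limit by <:].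
HB.instance Definition _ := [SubChoice_isSubComNzRing of limit by <:].

Implicit Types f g : limit.

Lemma limit_retracting f : retracting f.
Proof. by case: f => f /= /asboolP[]. Qed.

Lemma limit_coherent f : exists N, coherent_from N f.
Proof. by case: f => f /= /asboolP[]. Qed.

Lemma coherent_fromW M N (f : forall n, R n) :
  (M <= N)%N -> coherent_from M f -> coherent_from N f.
Proof. by move=> MN cf n Nn; apply: cf; exact: leq_trans Nn. Qed.

(** From the index [N] on, the terms are determined by the [phi n], and below
    [N] by the [rho n]. *)
Lemma limit_eq N f g : coherent_from N f -> coherent_from N g ->
  f N = g N -> f = g.
Proof.
move=> cf cg fgN; have fg_above k : f (k + N)%N = g (k + N)%N.
  elim: k => //= k IHk.
  by rewrite [LHS]cf ?leq_addl // [RHS]cg ?leq_addl // IHk.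
have fg_below k n : f (k + n)%N = g (k + n)%N -> f n = g n.
  elim: k => //= k IHk fg_k; apply: IHk.
  by rewrite -(limit_retracting f) -(limit_retracting g); congr (rho _ _).
apply: val_inj; apply: functional_extensionality_dep => n.
by apply: (fg_below N); rewrite addnC.
Qed.

Lemma limit_domain_axiom : GRing.integral_domain_axiom limit.
Proof.
move=> f g fg0.
have [M cf] := limit_coherent f; have [N cg] := limit_coherent g.
pose K := maxn M N.
have {}cf : coherent_from K f by apply: coherent_fromW cf; exact: leq_maxl.
have {}cg : coherent_from K g by apply: coherent_fromW cg; exact: leq_maxr.
have c0 : coherent_from K (0 : limit) by move=> n _; rewrite rmorph0.
have : f K * g K == 0.
  by apply/eqP; exact: (congr1 (fun h : limit => h K) fg0).
rewrite mulf_eq0 => /orP[/eqP fK|/eqP gK]; apply/orP; [left|right]; apply/eqP.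
  exact: limit_eq cf c0 fK.
exact: limit_eq cg c0 gK.
Qed.

Definition limit_domain : idomainType := domain_of limit_domain_axiom.

End Tower.

(** By induction on [N], for all chains at once: dropping the first ring of the
    chain lowers [N], and the missing term is recovered by retraction. *)
Lemma exists_coherent (R : nat -> idomainType)
    (phi : forall n, {rmorphism R n -> R n.+1})
    (rho : forall n, {rmorphism R n.+1 -> R n}) :
  (forall n, cancel (phi n) (rho n)) ->
  forall N (x : R N), exists f : forall n, R n,
    [/\ retracting rho f, coherent_from phi N f & f N = x].
Proof.
move=> phiK N; elim: N => [|N IHN] in R phi rho phiK *; move=> x.
  exists (nat_rect R x (fun n => phi n)); split=> // n /=; exact: phiK.
have [f [rf cf fN]] := IHN (fun n => R n.+1) (fun n => phi n.+1)
  (fun n => rho n.+1) (fun n => phiK n.+1) x.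
exists (fun n => if n is n'.+1 then f n' else rho 0%N (f 0%N)).
split=> [[|n] /=|[|n] //= Nn|//]; [by []|exact: rf|exact: cf].
Qed.

Section LimitInjection.
Variables (R : nat -> idomainType) (phi : forall n, {rmorphism R n -> R n.+1})
  (rho : forall n, {rmorphism R n.+1 -> R n})
  (phiK : forall n, cancel (phi n) (rho n)).

Let inj_ex n (x : R n) :
  exists f : limit phi rho, coherent_from phi n f /\ f n = x.
Proof.
have [f [rf cf fn]] := exists_coherent phiK x.
have flim : (f : prod_ring R) \in limit_pred phi rho.
  by apply/asboolP; split=> //; exists n.
by exists (Limit flim).
Qed.

Definition limit_inj n (x : R n) : limit phi rho := projT1 (cid (inj_ex x)).

Lemma limit_inj_coherent n (x : R n) : coherent_from phi n (limit_inj x).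
Proof. by rewrite /limit_inj; case: cid => f []. Qed.

Lemma limit_injE n (x : R n) : limit_inj x n = x.
Proof. by rewrite /limit_inj; case: cid => f []. Qed.

Let injB n : zmod_morphism (@limit_inj n).
Proof.
move=> x y; apply: (@limit_eq _ _ _ n); first exact: limit_inj_coherent.
  move=> m nm.
  rewrite -[coord (_ - _)]/(fun n => limit_inj x n - limit_inj y n).
  by rewrite /= !limit_inj_coherent // rmorphB.
by rewrite limit_injE -[RHS]/(limit_inj x n - limit_inj y n) !limit_injE.
Qed.

Let injM n : monoid_morphism (@limit_inj n).
Proof.
split=> [|x y]; apply: (@limit_eq _ _ _ n); try exact: limit_inj_coherent.
- by move=> m nm; rewrite -[coord 1]/(fun n => 1 : R n) rmorph1.
- by rewrite limit_injE.
- move=> m nm.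
  rewrite -[coord (_ * _)]/(fun n => limit_inj x n * limit_inj y n).
  by rewrite /= !limit_inj_coherent // rmorphM.
by rewrite limit_injE -[RHS]/(limit_inj x n * limit_inj y n) !limit_injE.
Qed.

HB.instance Definition _ n := GRing.isZmodMorphism.Build
  (R n) (limit phi rho) (@limit_inj n) (@injB n).
HB.instance Definition _ n := GRing.isMonoidMorphism.Build
  (R n) (limit phi rho) (@limit_inj n) (@injM n).

Lemma direct_limit :
  exists (L : idomainType) (iota : forall n, {rmorphism R n -> L}),
  [/\ forall n x, iota n.+1 (phi n x) = iota n x, forall n, injective (iota n)
    & forall g, exists n x, g = iota n x].
Proof.
exists (limit_domain phi rho), (fun n => @limit_inj n).
split=> [n x|n x y xy|g].
- apply: (@limit_eq _ _ _ n.+1); first exact: limit_inj_coherent.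
    by apply: coherent_fromW (limit_inj_coherent x).
  by rewrite limit_injE limit_inj_coherent // limit_injE.
- rewrite -[x]limit_injE -[y]limit_injE.
  exact: (congr1 (fun f : limit phi rho => f n) xy).
- have [N cg] := limit_coherent (g : limit phi rho).
  exists N, ((g : limit phi rho) N); apply: (@limit_eq _ _ _ N) => //.
    exact: limit_inj_coherent.
  by rewrite limit_injE.
Qed.
End LimitInjection.

(** * Chains of conservative extensions *)

Section LimitConservative.
Variables (R : nat -> idomainType) (phi : forall n, {rmorphism R n -> R n.+1}).
Variables (S : forall n, set (R n)).
Hypotheses (phi_cons : forall n, conservative (phi n) (@S n))
  (S_succ : forall n, @S n.+1 = phi n @` @S n).
Variables (L : idomainType) (iota : forall n, {rmorphism R n -> L}).
Hypotheses (iota_phi : forall n x, iota n.+1 (phi n x) = iota n x)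
  (iota_inj : forall n, injective (iota n))
  (iota_surj : forall g, exists n x, g = iota n x).

Lemma limit_lift k n (x : R n) :
  exists y : R (k + n)%N, iota (k + n) y = iota n x.
Proof.
elim: k => [|k [y yx]]; first by exists x.
by exists (phi (k + n) y); rewrite [LHS]iota_phi.
Qed.

(** A quotient of the two elements in the limit comes from a later stage, and
    from there divisibility descends one stage at a time. *)
Lemma limit_divides n (x y : R n) :
  divides (iota n x) (iota n y) -> divides x y.
Proof.
have descend k (x' y' : R (k + n)%N) : iota (k + n) x' = iota n x ->
    iota (k + n) y' = iota n y -> divides x' y' -> divides x y.
  elim: k => [|k IHk] in x' y' *; first by move=> /iota_inj-> /iota_inj->.
  have [x1 x1E] := limit_lift k x; have [y1 y1E] := limit_lift k y.
  rewrite -x1E -(iota_phi x1) -y1E -(iota_phi y1) => /iota_inj-> /iota_inj->.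
  by move=> /(phi_cons (k + n)).1; exact: IHk.
move=> [g]; have [m [z ->]] := iota_surj g.
have [x1 x1E] := limit_lift m x; have [y1 y1E] := limit_lift m y.
have [z1 z1E] : exists z1 : R (m + n)%N, iota (m + n) z1 = iota m z.
  by rewrite addnC; exact: limit_lift.
rewrite -x1E -y1E -z1E -rmorphM => /iota_inj y1M.
by apply: (descend m x1 y1) => //; exists z1.
Qed.

Lemma limit_unit n (x : R n) : iota n x \is a GRing.unit -> x \is a GRing.unit.
Proof.
by move=> /divides1P; rewrite -(rmorph1 (iota n)) => /limit_divides/divides1P.
Qed.

Lemma limit_atom n (x : R n) : atom (iota n x) -> atom x.
Proof.
move=> [x0 xN x_irr]; split.
- by apply: contraNneq x0 => ->; rewrite rmorph0.
- by apply: contra xN => xU; rewrite rmorph_unit.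
move=> [a [b [aN bN xE]]]; apply: x_irr; exists (iota n a), (iota n b).
split; [| |by rewrite xE rmorphM].
  by apply: contra aN; exact: limit_unit.
by apply: contra bN; exact: limit_unit.
Qed.

Fixpoint tower_up n : {rmorphism R 0 -> R n} :=
  if n is n'.+1 return {rmorphism R 0 -> R n} then phi n' \o tower_up n'
  else idfun.

Lemma tower_up_image n : tower_up n @` @S 0 = @S n.
Proof.
elim: n => [|n IHn]; first by rewrite image_id.
by rewrite S_succ -IHn -image_comp.
Qed.

Lemma tower_up_conservative n : conservative (tower_up n) (@S 0).
Proof.
elim: n => [|n IHn]; first exact: conservative_id.
by apply: conservative_comp => //; rewrite tower_up_image.
Qed.

Lemma limit_tower_up n x : iota n (tower_up n x) = iota 0 x.
Proof. by elim: n => //= n IHn; rewrite iota_phi. Qed.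

(** An element of the limit lives at some stage [n], and its witness for the
    extension from [R 0] to [R n] serves for the limit. *)
Lemma limit_conservative : conservative (iota 0) (@S 0).
Proof.
split=> [x y|g]; first exact: limit_divides.
have [n [x ->]] := iota_surj g.
have [[y ->]|[a [aN aS a_div]]] := (tower_up_conservative n).2 x.
  by left; exists y; rewrite limit_tower_up.
right; exists a; split=> // c c0; rewrite -(limit_tower_up n) => /limit_divides.
exact: a_div.
Qed.

Hypotheses (S0_atoms : @S 0 `<=` atoms (R 0)) (S0_unit : unit_closed (@S 0)).
Hypothesis phi_split : forall n a, atom a -> ~ @S n a -> ~ atom (phi n a).

(** An atom [g] of the limit is represented at two consecutive stages by [x] and
    [phi n x], both of them atoms, so [x] is in [S n]. *)
Lemma limit_atoms : atoms L = iota 0 @` @S 0.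
Proof.
apply/seteqP; split; last exact: conservative_atoms limit_conservative _ _.
move=> g; have [n [x ->]] := iota_surj g => g_atom.
have [|xS] := pselect (@S n x).
  rewrite -tower_up_image => -[s Ss <-].
  by exists s => //; rewrite limit_tower_up.
case: (phi_split (limit_atom g_atom) xS); apply: limit_atom.
by rewrite iota_phi.
Qed.

End LimitConservative.

Record marked_domain :=
  MarkedDomain { marked_ring : idomainType; marks : set marked_ring }.

Definition split_next (X : marked_domain) : marked_domain :=
  MarkedDomain (split_inj (@marks X) @` @marks X).

(** Splitting the atoms outside [S] creates new atoms outside [S], so the step
    is iterated and [L] is the union of the resulting chain. *)
Lemma atoms_extension (D : idomainType) (S : set D) :
  S `<=` atoms D -> unit_closed S ->
  exists (L : idomainType) (f : {rmorphism D -> L}),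
    conservative f S /\ atoms L = f @` S.
Proof.
move=> S_atoms S_unit; pose X n := iter n split_next (MarkedDomain S).
have X_good n :
    @marks (X n) `<=` atoms (marked_ring (X n)) /\ unit_closed (@marks (X n)).
  elim: n => //= n [X_atoms X_unit]; have X_cons := split_conservative X_atoms.
  split; first exact: conservative_atoms X_cons _ _.
  exact: conservative_unit_closed X_cons _.
pose phi n : {rmorphism marked_ring (X n) -> marked_ring (X n.+1)} :=
  split_inj (@marks (X n)).
have phi_cons n : conservative (phi n) (@marks (X n)).
  exact: split_conservative (X_good n).1.
have [L [iota [iota_phi iota_inj iota_surj]]] :=
  @direct_limit (fun n => marked_ring (X n)) phi
    (fun n => split_retract (@marks (X n)))
    (fun n => @split_injK _ (@marks (X n))).
exists L, (iota 0%N); split.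
  exact: (limit_conservative (S := fun n => @marks (X n)) (phi := phi)).
apply: (limit_atoms (S := fun n => @marks (X n)) (phi := phi)) => // n a.
exact: split_not_atom (X_good n).1 _.
Qed.

(** * A domain with infinitely many maximal common divisors *)

Section ManyMCDs.
Variable D : idomainType.

(** The exponents are pairs, [x false] being the degree in [X] and [x true] the
    degree in [Y]; the ring is [D + Y D[X, 1/X][Y]]. *)
Definition mcd_component (x : bool -> int) : set D :=
  [set c | [\/ c = 0, x = 0 | 0 < x true]].

Lemma mcd_component0 x : mcd_component x 0. Proof. exact: Or31. Qed.

Lemma mcd_componentB x c d :
  mcd_component x c -> mcd_component x d -> mcd_component x (c - d).
Proof.
move=> [c0|x0|x_pos]; [|by move=> _; exact: Or32|by move=> _; exact: Or33].
move=> [d0|x0|x_pos]; [|exact: Or32|exact: Or33].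
by apply: Or31; rewrite c0 d0 subrr.
Qed.

Lemma mcd_componentM x y c d :
  mcd_component x c -> mcd_component y d -> mcd_component (x + y) (c * d).
Proof.
move=> [->|->|x_pos] [->|->|y_pos]; rewrite ?mul0r ?mulr0 ?add0r ?addr0;
  try by [exact: Or31|exact: Or32|exact: Or33].
by apply: Or33; exact: addr_gt0.
Qed.

Lemma mcd_component_const c : mcd_component 0 c. Proof. exact: Or32. Qed.

Definition mcd_family := ComponentFamily mcd_component0 mcd_componentB
  mcd_componentM mcd_component_const.

Definition mcd_domain : idomainType :=
  graded_domain mcd_family (orderable_int_fun bool).

Definition mcd_inj : {rmorphism D -> mcd_domain} := @gconst D _ mcd_family.

(** For [x] nonzero, [x] and [- x] do not both have positive degree in [Y], so
    one of the two components is [0]. *)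
Lemma mcd_conservative (S : set D) : ~ S 0 -> conservative mcd_inj S.
Proof.
move=> S0; apply: gconst_conservative => // x x0.
exists 0; rewrite unitr0; split=> // c d Ic Id.
suff -> : c * d = 0 by exact: dividesxx.
have xN0 : x <> 0 by exact/eqP.
case: Ic => [->|//|x_pos]; first by rewrite mul0r.
case: Id => [->|/eqP|]; rewrite ?mulr0 ?oppr_eq0 ?(negbTE x0) //.
by rewrite /GRing.opp /= oppr_gt0 => /(lt_trans x_pos); rewrite ltxx.
Qed.

Let deg (i j : int) : bool -> int := fun b => if b then j else i.

Let degD i j k l : deg i j + deg k l = deg (i + k) (j + l).
Proof. by apply/funext => -[]. Qed.

Let deg_inj i j k l : deg i j = deg k l -> i = k.
Proof. exact: (congr1 (@^~ false)). Qed.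

Let deg_pos i j : 0 < j -> mcd_family (deg i j) 1.
Proof. by move=> j_pos; exact: Or33. Qed.

Let xmono i j (j_pos : 0 < j) : mcd_domain := gmono (deg_pos i j_pos).

Let xmonoM i j k l m n (j_pos : 0 < j) (l_pos : 0 < l) (n_pos : 0 < n) :
  i + k = m -> j + l = n -> xmono m n_pos = xmono i j_pos * xmono k l_pos.
Proof.
move=> mE nE; apply: (@graded_inj D _ mcd_family).
by rewrite [RHS]gmulE /= conv_mono degD mul1r mE nE.
Qed.

Let xmono_neq0 i j (j_pos : 0 < j) : xmono i j_pos != 0.
Proof.
apply/eqP => /(congr1 (fun f : graded mcd_family => f (deg i j))).
by rewrite /= /mono eqxx; apply/eqP; exact: oner_neq0.
Qed.

(** The elements are [Y^2] and [X Y^2], with common divisors [X^k Y].  The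
    cofactors [X^(- k) Y] and [X^(1 - k) Y] are coprime: having degree [1] in
    [Y], a common divisor of them with positive degree in [Y] would equal both
    up to constant factors. *)
Lemma mcd_many_MCDs : exists (x y : mcd_domain) c, many_MCDs x y c.
Proof.
have pos1 : 0 < 1 :> int by []; have pos2 : 0 < 2 :> int by [].
exists (xmono 0 pos2), (xmono 1 pos2), (fun k => xmono k%:Z pos1).
split; [exact: xmono_neq0|exact: xmono_neq0|move=> k|move=> k l].
  exists (xmono (- k%:Z) pos1), (xmono (1 - k%:Z) pos1); split.
  - by apply: xmonoM => //; rewrite subrr.
  - by apply: xmonoM => //; rewrite subrKC.
  move=> g [h gh] [h' gh'].
  have fin (f : mcd_domain) : finite_set (supp (f : graded mcd_family)).
    exact: graded_finite.
  have gh_mono := esym (congr1 (@graded_val _ _ mcd_family) gh).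
  have gh'_mono := esym (congr1 (@graded_val _ _ mcd_family) gh').
  have [x [y [gE _ xyE gh1]]] := conv_eq_mono (orderable_int_fun bool)
    (fin g) (fin h) (oner_neq0 D) gh_mono.
  have [x' [y' [gE' _ xyE' gh1']]] := conv_eq_mono (orderable_int_fun bool)
    (fin g) (fin h') (oner_neq0 D) gh'_mono.
  have unit_coef a b : a * b = 1 -> a != 0 /\ b != 0 :> D.
    by move=> ab; apply/andP; rewrite -negb_or -mulf_eq0 ab oner_neq0.
  have [gx0 hy0] := unit_coef _ _ gh1; have [gx'0 hy'0] := unit_coef _ _ gh1'.
  have xx' : x = x' by exact: mono_index_inj gx0 (etrans (esym gE) gE').
  have support (f : mcd_domain) z :
      (f : graded mcd_family) z != 0 -> z = 0 \/ 0 < z true.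
    move=> fz.
    have [fz0|z0|z_pos] := graded_component (f : graded mcd_family) z.
    - by rewrite fz0 eqxx in fz.
    - by left.
    - by right.
  (* [x] is the exponent of the common divisor [g]. *)
  have [x0|x_pos] := support g x gx0.
    have -> : g = mcd_inj ((g : graded mcd_family) 0).
      by apply: (@graded_inj D _ mcd_family); rewrite x0 in gE; exact: gE.
    apply: rmorph_unit; apply/unitrPr; exists ((h : graded mcd_family) y).
    by rewrite -x0.
  have rest0 (f : mcd_domain) z i : (f : graded mcd_family) z != 0 ->
      x + z = deg i 1 -> x = deg i 1.
    move=> fz xzE; have [z0|z_pos] := support f z fz.
      by rewrite -xzE z0 addr0.
    have := congr1 (@^~ true) xzE; rewrite /GRing.add /= /deg.
    by move: x_pos z_pos; lia.
  have xE := rest0 h y _ hy0 xyE.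
  have xE' : x = deg (1 - k%:Z) 1 by apply: (rest0 h' y') hy'0 _; rewrite xx'.
  by have := deg_inj (etrans (esym xE) xE'); lia.
move=> [_ [/(conservative_unit_lift (@mcd_conservative set0 id))[u _ ->]]].
move=> /(congr1 (@graded_val _ _ mcd_family)).
rewrite [RHS]gmulE /= conv_mono add0r.
by move=> /(mono_index_inj (oner_neq0 D))/deg_inj [].
Qed.

End ManyMCDs.

(** * The extension theorem *)

Theorem theorem2p5 (D : idomainType) (S : set D)
    (S_atoms : S `<=` atoms D) (S_unit_closed : unit_closed S) :
  exists (R : idomainType) (f : {rmorphism D -> R}),
    [/\ injective f,
        ~ MCD_finite R,
        atoms R = f @` S,
        division_preserving f
      & ~ (exists A : set D,
             [/\ A `<=` S, infinite_set A & pairwise_nonassociate A]) ->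
        IDF R].
Proof.
have mcd_cons := mcd_conservative (atoms_neq0 S_atoms).
have [x [y [c c_MCDs]]] := mcd_many_MCDs D.
have [R [g [g_cons R_atoms]]] := atoms_extension
  (conservative_atoms mcd_cons S_atoms S_unit_closed)
  (conservative_unit_closed mcd_cons S_unit_closed).
pose f : {rmorphism D -> R} := g \o mcd_inj D.
have f_cons : conservative f S by exact: conservative_comp.
have f_inj := conservative_inj f_cons.
have atomsE : atoms R = f @` S by rewrite R_atoms image_comp.
exists R, f; split=> //.
- exact: many_MCDs_not_MCD_finite (conservative_many_MCDs g_cons c_MCDs).
- by move=> a b _ _; exact: f_cons.1.
move=> no_inf z z0 A A_div A_nonassoc.
have AE : A = f @` (f @^-1` A).
  apply/seteqP; split=> [b Ab|_ [a Aa <-]//]; have [b_atom _] := A_div b Ab.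
  have : (f @` S) b by rewrite -atomsE.
  by move=> [s _ sb]; exists s => //; rewrite -sb in Ab; exact: Ab.
rewrite AE; apply: finite_image; apply: contrapT => A_inf; apply: no_inf.
exists (f @^-1` A); split=> // [a /A_div[fa_atom _]|a b Aa Ab ab].
  have : (f @` S) (f a) by rewrite -atomsE.
  by move=> [s Ss /f_inj <-].
move=> [u [uU abE]]; apply: (A_nonassoc (f a) (f b) Aa Ab); first by move/f_inj.
by exists (f u); rewrite rmorph_unit // abE rmorphM.
Qed.
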